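(* Let $\iota$ be a positive integer, $0<q\leq 1\leq r\leq\infty$, $\varepsilon\geq 0$, and $A\in\mathbb{R}^{m\times n}$. Let $D_1\in\mathbb{R}^{n\times d_1},\dots,D_\iota\in\mathbb{R}^{n\times d_\iota}$ be arbitrary tight frames for $\mathbb{R}^n$ with frame bound $1$; set $\bar{d}=d_1+\cdots+d_\iota$, $$\bar{D}=[D_1|D_2|\cdots|D_\iota]\in\mathbb{R}^{n\times\bar d},\quad \Psi=\mathrm{diag}(D_1,D_2,\dots,D_\iota)\in\mathbb{R}^{\iota n\times\bar d},\quad f=(f_1^T,\dots,f_\iota^T)^T\in\mathbb{R}^{\iota n},$$ and suppose we observe $y=A(f_1+\cdots+f_\iota)+z$ with $\|z\|_r\leq\varepsilon$. Let $s=s_1+\cdots+s_\iota$ for given positive integers $s_1,\dots,s_\iota$, and fix a positive integer $a>s$; set $\rho=s/a$ and $\Delta=\frac{1+\delta_a}{1-\delta_{s+a}}$, where $\delta_k$ are the $(\bar{D},q)$-RIP constants of $A$. Assume that the mutual coherence $\mu_1$ between $D_1,\dots,D_\iota$ satisfies $$\mu_1(s+a)(\rho^{2/q-1}+1)<1,$$ and that $$\Delta\rho^{1-q/2}(\rho^{2/q-1}+1)^{q/2}<(2\iota)^{-q/2}.$$ Then any solution $\hat{f}$ of $$\min_{\tilde{f}\in\mathbb{R}^{\iota n}}\|\Psi^*\tilde{f}\|_q\quad\text{subject to}\quad\|A\bar{D}\Psi^*\tilde{f}-y\|_r\leq\varepsilon$$ obeys $$\|\hat{f}-f\|_2\leq\tilde{C}_1\frac{\|\Psi^*f-(\Psi^*f)_{[s]}\|_q}{s^{1/q-1/2}}+\tilde{C}_2m^{1/q-1/r}\varepsilon$$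 and $$\|\Psi^*\hat{f}-\Psi^*f\|_q^q\leq\tilde{C}_3\|\Psi^*f-(\Psi^*f)_{[s]}\|_q^q+\tilde{C}_4a^{1-q/2}m^{1-q/r}\varepsilon^q,$$ where $\tilde{C}_1,\tilde{C}_2,\tilde{C}_3,\tilde{C}_4$ are positive constants depending only on $\delta_a$, $\delta_{s+a}$, $\rho$, $\iota$ and $q$.
   Context: A tight frame for $\mathbb{R}^n$ with frame bound $1$ is $D\in\mathbb{R}^{n\times d}$ with $\|D^*g\|_2=\|g\|_2$ for all $g\in\mathbb{R}^n$ (equivalently $DD^*=I$); note $\bar D\Psi^*\tilde f=\sum_k D_kD_k^*\tilde f_k=\sum_k\tilde f_k$. $A$ obeys the $(\bar{D},q)$-RIP of order $k$ with constant $\delta\in[0,1)$ if $(1-\delta)\|\bar{D}v\|_2^q\leq\|A\bar{D}v\|_q^q\leq(1+\delta)\|\bar{D}v\|_2^q$ for all $v\in\mathbb{R}^{\bar d}$ with at most $k$ nonzero entries; $\delta_k$ is the smallest such $\delta$. If $D_k$ has columns $d_{k1},\dots,d_{kd_k}$, the mutual coherence is $\mu_1=\max_{k\neq l}\max_{i,j}|\langle d_{ki},d_{lj}\rangle|$. $x_{[s]}$ keeps the $s$ largest entries of $x$ in magnitude and zeros the rest. *)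

(* Defs.v *)
From HB Require Import structures.
From mathcomp Require Import all_boot all_order all_algebra.
From mathcomp Require Import all_classical all_reals all_analysis.
Set Implicit Arguments. Unset Strict Implicit. Unset Printing Implicit Defensive.
Import Order.TTheory GRing.Theory Num.Theory.
Local Open Scope ring_scope.

Section Defs.
Variable R : realType.

Definition lq_pow (q : R) k (v : 'cV[R]_k) : R := \sum_i `|v i 0| `^ q.
Definition lq_norm (q : R) k (v : 'cV[R]_k) : R := (lq_pow q v) `^ q^-1.
Definition l2_norm k (v : 'cV[R]_k) : R := Num.sqrt (\sum_i (v i 0) ^+ 2).
Definition lr_norm (r : \bar R) k (v : 'cV[R]_k) : R :=
  match r with
  | EFin x => (\sum_i `|v i 0| `^ x) `^ x^-1
  | _ => \big[Num.max/0]_i `|v i 0|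
  end.
Definition inv_ext (r : \bar R) : R :=
  match r with EFin x => x^-1 | _ => 0 end.

Definition tight_frame n d (D : 'M[R]_(n, d)) : Prop := D *m D^T = 1%:M.

Definition sparse k d (v : 'cV[R]_d) : Prop := (#|[set i | v i ord0 != 0%R]| <= k)%N.

Definition rip m n d (A : 'M[R]_(m, n)) (Dbar : 'M[R]_(n, d)) (q : R) (k : nat)
    (delta : R) : Prop :=
  0 <= delta < 1 /\
  forall v : 'cV[R]_d, sparse k v ->
    (1 - delta) * (l2_norm (Dbar *m v)) `^ q <= lq_pow q (A *m (Dbar *m v)) /\
    lq_pow q (A *m (Dbar *m v)) <= (1 + delta) * (l2_norm (Dbar *m v)) `^ q.

Definition rip_const m n d (A : 'M[R]_(m, n)) (Dbar : 'M[R]_(n, d)) (q : R)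
    (k : nat) (delta : R) : Prop :=
  rip A Dbar q k delta /\ forall delta', rip A Dbar q k delta' -> delta <= delta'.

(* x_[s]: keep the s largest entries in magnitude (ties broken by index order) *)
Definition keep_largest (s : nat) k (x : 'cV[R]_k) : 'cV[R]_k :=
  \col_i (if i \in take s (sort (fun i j : 'I_k => `|x j 0| <= `|x i 0|) (enum 'I_k))
          then x i 0 else 0).

Definition mutual_coherence iota n (d : 'I_iota -> nat)
    (D : forall k : 'I_iota, 'M[R]_(n, d k)) : R :=
  \big[Num.max/0]_(k < iota) \big[Num.max/0]_(l < iota | l != k)
    \big[Num.max/0]_(i < d k) \big[Num.max/0]_(j < d l)
      `| ((col i (D k))^T *m col j (D l)) 0 0 |.

Definition Dbar_of iota n (d : 'I_iota -> nat)
    (D : forall k : 'I_iota, 'M[R]_(n, d k)) : 'M[R]_(n, \sum_(k < iota) d k) :=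
  \mxrow_(k < iota) D k.

Definition Psi_of iota n (d : 'I_iota -> nat)
    (D : forall k : 'I_iota, 'M[R]_(n, d k))
    : 'M[R]_(\sum_(k < iota) n, \sum_(k < iota) d k) :=
  @mxblock R iota iota (fun _ => n) d
    (fun k l => if k == l then conform_mx 0 (D k) else 0).

Definition stack iota n (f : 'I_iota -> 'cV[R]_n) : 'cV[R]_(\sum_(k < iota) n) :=
  @mxcol R iota (fun _ => n) 1 f.

End Defs.

(* Main.v *)
(* Write u = Psi^T (fhat - f), th = q/2 and kap = rho^(2/q-1), let T be the set of
   indices kept in (Psi^T f)_[s], and cut the complement of T into successive
   blocks T_1, T_2, ... of the a largest entries of u; v is u restricted to
   T and T_1. Minimality of fhat gives the cone condition on T, hence
   |u - v|^2 <= kap |v|^2 up to the compression error, and the RIP gives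
   |Dbar v|^q <= Delta * sum_(j >= 2) |Dbar u_(T_j)|^q up to the noise.

   Since Psi is a tight frame and u is in the range of Psi^T, Cauchy-Schwarz gives
   |v|^4 <= |Psi v|^2 |u|^2. The matrices Dbar^T Dbar and Psi^T Psi differ only by
   cross-frame inner products, all bounded by mu_1, so on k-sparse vectors
   | |Dbar w|^2 - |Psi w|^2 | <= (1 - 1/iota) mu_1 k |w|^2. With the coherence
   assumption this yields both |Dbar v|^2 >= |v|^2 / (iota (1 + kap)) (up to the
   error terms) and |Dbar u_(T_j)|^2 <= 2 |u_(T_j)|^2. The last bound, instead of
   the crude factor iota, is what makes the assumption on Delta sufficient for
   every iota, with constants that do not involve mu_1. *)
Require Import Defs.
From HB Require Import structures.
From mathcomp Require Import all_boot all_order all_algebra.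
From mathcomp Require Import all_classical all_reals all_analysis.
From mathcomp Require Import ring lra.
Import Order.TTheory GRing.Theory Num.Theory.
Local Open Scope ring_scope.
Set Implicit Arguments. Unset Strict Implicit. Unset Printing Implicit Defensive.

(** * Real powers: subadditivity, tangent lines and power means *)

Section PowerInequalities.
Variable R : realType.
Implicit Types (t x y : R).

Lemma powRVK t x : t != 0 -> 0 <= x -> (x `^ t) `^ t^-1 = x.
Proof. by move=> t0 x0; rewrite -powRrM mulfV ?powRr1. Qed.

Lemma powRKV t x : t != 0 -> 0 <= x -> (x `^ t^-1) `^ t = x.
Proof. by move=> t0 x0; rewrite -powRrM mulVf ?powRr1. Qed.

Lemma ler_powRl t x y : 0 <= t -> 0 <= x -> x <= y -> x `^ t <= y `^ t.
Proof.
by move=> t0 x0 xy; apply: ge0_ler_powR => //; rewrite nnegrE // (le_trans x0).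
Qed.

Lemma ler_powR_cancel t x y :
  0 < t -> 0 <= x -> 0 <= y -> x `^ t <= y `^ t -> x <= y.
Proof.
move=> t0 x0 y0 xy; rewrite leNgt; apply/negP => yx.
have := gt0_ltr_powR t0; rewrite /in_mem /= => /(_ y x).
by rewrite !nnegrE => /(_ y0 x0 yx); rewrite ltNge xy.
Qed.

(** The ratios x/(x+y) and y/(x+y) lie in [0,1], so each is at most its t-th power, and they add up
    to 1. *)
Lemma powR_subadditive t x y :
  0 < t -> t <= 1 -> 0 <= x -> 0 <= y -> (x + y) `^ t <= x `^ t + y `^ t.
Proof.
move=> t0 t1 x0 y0.
have [S0|S0] := eqVneq (x + y) 0.
  by rewrite S0 powR0 ?gt_eqF // addr_ge0 ?powR_ge0.
have Sp : 0 < x + y by rewrite lt_def S0 addr_ge0.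
have le_powR z : 0 <= z -> z <= x + y -> z / (x + y) <= (z / (x + y)) `^ t.
  move=> z0 zS; have [->|zn] := eqVneq z 0; first by rewrite mul0r powR_ge0.
  have zp : 0 < z by rewrite lt_def zn.
  by apply: ger1_powR => //; rewrite divr_gt0 //= ler_pdivrMr // mul1r.
have hx : x / (x + y) <= (x / (x + y)) `^ t by apply: le_powR; rewrite // lerDl.
have hy : y / (x + y) <= (y / (x + y)) `^ t by apply: le_powR; rewrite // lerDr.
have /(ler_wpM2r (powR_ge0 (x + y) t)) := lerD hx hy.
rewrite -mulrDl divff // mul1r mulrDl -!powRM ?divr_ge0 ?addr_ge0 //.
by rewrite !divfK.
Qed.

(** The sum is at most twice the larger term. This serves the exponent 1/q >= 1, where subadditivity
    fails. *)
Lemma powRD_le2 t x y :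
  0 <= t -> 0 <= x -> 0 <= y -> (x + y) `^ t <= 2 `^ t * (x `^ t + y `^ t).
Proof.
move=> t0 x0 y0.
wlog xy : x y x0 y0 / x <= y.
  move=> H; have [|/ltW] := leP x y; first exact: H.
  by rewrite addrC [_ `^ t + _]addrC; exact: H.
apply: (@le_trans _ _ ((2 * y) `^ t)).
  by apply: ler_powRl; rewrite ?addr_ge0 //; lra.
by rewrite powRM // ler_wpM2l ?powR_ge0 // lerDr powR_ge0.
Qed.

(** The concave power lies below its tangent at 1; for t < 1 this is Young's inequality for x^t and
    1 with exponents 1/t and 1/(1-t). *)
Lemma powR_le_tangent t x : 0 < t -> t <= 1 -> 0 <= x -> x `^ t <= t * x + (1 - t).
Proof.
move=> t0 t1 x0; have [->|tn1] := eqVneq t 1.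
  by rewrite powRr1 // mul1r subrr addr0.
have tl1 : t < 1 by rewrite lt_def eq_sym tn1.
have := @conjugate_powR R (x `^ t) 1 t^-1 (1 - t)^-1 (powR_ge0 _ _) ler01.
rewrite !invr_gt0 subr_gt0 !invrK addrC subrK => /(_ t0 tl1 erefl).
by rewrite powR1 mulr1 powRVK ?gt_eqF // mul1r mulrC.
Qed.

(** Power mean inequality: sum the tangent inequality at the mean [c] of [g] over [B]; the linear
    terms add up to the cardinality [k]. *)
Lemma sum_powR_le (I : finType) (B : {set I}) (g : I -> R) t :
  0 < t -> t <= 1 -> (forall i, 0 <= g i) ->
  \sum_(i in B) g i `^ t <= #|B|%:R `^ (1 - t) * (\sum_(i in B) g i) `^ t.
Proof.
move=> t0 t1 g0; set S := \sum_(i in B) g i.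
have Sge : 0 <= S by apply: sumr_ge0.
have [S0|Sn] := eqVneq S 0.
  rewrite big1 ?mulr_ge0 ?powR_ge0 // => i iB.
  have /eqP := S0; rewrite psumr_eq0 // => /allP /(_ i (mem_index_enum _)).
  by rewrite iB /= => /eqP ->; rewrite powR0 ?gt_eqF.
have Sp : 0 < S by rewrite lt_def Sn.
have kp : 0 < #|B|%:R :> R.
  rewrite ltr0n lt0n; apply: contraNneq Sn => /cards0_eq B0.
  by rewrite /S B0 big_set0.
set k := #|B|%:R; pose c := S / k.
have cp : 0 < c by rewrite divr_gt0.
have term i : i \in B -> g i `^ t <= c `^ t * (t * (g i / c) + (1 - t)).
  move=> _; rewrite -[X in X `^ t <= _](divfK (lt0r_neq0 cp)).
  rewrite powRM ?divr_ge0 // ?(ltW cp) // mulrC ler_wpM2l ?powR_ge0 //.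
  by apply: powR_le_tangent; rewrite // divr_ge0 // ltW.
apply: (le_trans (ler_sum _ term)).
rewrite -mulr_sumr big_split /= -mulr_sumr -mulr_suml sumr_const -mulr_natr -/S -/k.
have -> : t * (S / c) + (1 - t) * k = k.
  by rewrite /c; field; rewrite (lt0r_neq0 Sp) (lt0r_neq0 kp).
rewrite /c powRM ?invr_ge0 ?(ltW kp) // -powR_inv1 ?(ltW kp) // -powRrM mulN1r.
rewrite powRB; last by rewrite (lt0r_neq0 kp) implybT.
by rewrite powRr1 ?(ltW kp) // powRN mulrAC [_ * k]mulrC mulrAC.
Qed.

End PowerInequalities.

(** * The scalar inequality that produces the constant *)

Section RecoveryConstant.
Variable R : realType.

(* [X], [Y] are the squared norms of [u] on and off the selected blocks, [P] and
   [G] those of the images of the selected part under [Psi] and [Dbar]. *)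
Definition recovery_bound (da dsa rho : R) (iota : nat) (q K : R) :=
  forall X Y P G w Z : R,
    0 <= X -> 0 <= Y -> 0 <= P -> 0 <= G -> 0 <= w -> 0 <= Z ->
    X ^+ 2 <= P * (X + Y) ->
    P <= G + (1 - iota%:R^-1) / (1 + rho `^ (2 / q - 1)) * X ->
    Y `^ (q / 2) <= rho `^ (1 - q / 2) * (X `^ (q / 2) + w) ->
    (1 - dsa) * G `^ (q / 2) <=
      Z + (1 + da) * 2 `^ (q / 2) * (rho `^ (1 - q / 2) * (X `^ (q / 2) + w)) ->
    X `^ (q / 2) <= K * (w + Z).

(** Without the errors [w] and [Z] the inequalities chain to X^th <= [Th] X^th, and the assumption
    says exactly [Th] < 1. The gap below 1 is spent on absorbing a small [w]. *)
Lemma recovery_constant (da dsa rho : R) (iota : nat) (q : R) :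
  (0 < iota)%N -> 0 < q -> q <= 1 -> 0 < rho -> 0 <= da -> 0 <= dsa < 1 ->
  (1 + da) / (1 - dsa) * rho `^ (1 - q / 2)
    * (rho `^ (2 / q - 1) + 1) `^ (q / 2) < (2 * iota%:R) `^ (- (q / 2)) ->
  exists2 K, 0 < K & recovery_bound da dsa rho iota q K.
Proof.
move=> iota0 q0 q1 rho0 da0 /andP[dsa0 dsa1].
rewrite /recovery_bound.
set th := q / 2; set kap := rho `^ (2 / q - 1); set i := iota%:R : R => Dlt.
have i1 : 1 <= i by rewrite ler1n.
clearbody i.
have i0 : 0 < i by lra.
have th0 : 0 < th by rewrite /th; lra.
have kap0 : 0 < kap by apply: powR_gt0.
have kapE : rho `^ (1 - th) = kap `^ th.
  by rewrite /kap -powRrM; congr (_ `^ _); rewrite /th; field; rewrite gt_eqF.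
rewrite kapE in Dlt *; clearbody kap th => {kapE}.
have d1 : 0 < 1 - dsa by lra.
set Dt := (1 + da) / (1 - dsa) in Dlt.
have Dt0 : 0 < Dt by rewrite divr_gt0 //; lra.
have DtE : 1 + da = Dt * (1 - dsa) by rewrite /Dt divfK // gt_eqF.
clearbody Dt; rewrite DtE => {DtE}.
pose B := (i * (1 + kap)) `^ th.
have B0 : 0 < B by apply: powR_gt0; rewrite mulr_gt0 //; lra.
pose Th := Dt * 2 `^ th * kap `^ th * B.
have Th0 : 0 < Th by rewrite /Th; do !apply: mulr_gt0 => //; apply: powR_gt0.
have Th1 : Th < 1.
  have p0 : 0 < (2 * i) `^ th by apply: powR_gt0; rewrite mulr_gt0.
  move: Dlt; rewrite powRN -(ltr_pM2r p0) mulVf ?gt_eqF //.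
  congr (_ < 1); rewrite /Th /B !powRM ?(ltW i0) //; last by lra.
  by rewrite [kap + 1]addrC; ring.
have ThE : Dt * 2 `^ th * kap `^ th * B = Th by [].
have BE : B = (i * (1 + kap)) `^ th by [].
clearbody B Th.
(* Taking the root moves the gap from th-th powers to the quantities themselves, where it can be
   divided linearly. *)
pose vt := Th `^ th^-1.
have vt0 : 0 < vt by apply: powR_gt0.
have vtE : vt `^ th = Th by rewrite powRKV ?gt_eqF // ltW.
have vt1 : vt < 1.
  rewrite ltNge; apply/negP => v1.
  have := ler_powRl (ltW th0) ler01 v1.
  by rewrite vtE powR1 leNgt Th1.
clearbody vt.
have i2 : 0 < 2 * (i + 1) by lra.
(* Chosen so that [1 - (i + 1) * xi] is the midpoint of [vt] and 1; hence (1 + vt)/2 <= (1 - i xi)(1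
   - xi). *)
pose xi : R := (1 - vt) / (2 * (i + 1)).
have xiE : xi * (2 * (i + 1)) = 1 - vt by rewrite /xi divfK // gt_eqF.
have xi0 : 0 < xi by rewrite divr_gt0 //; lra.
clearbody xi.
have xih : xi < 2^-1 by nra.
pose g : R := (1 - xi)^-1.
have g1 : 1 < g by rewrite invf_gt1; lra.
have gE : g * (1 - xi) = 1 by rewrite /g mulVf // gt_eqF //; lra.
have giE : g^-1 = 1 - xi by rewrite /g invrK.
clearbody g.
have gp : 0 < g by lra.
have kap1 : 0 < 1 + kap by lra.
have gk : 0 < g * (1 + kap) by rewrite mulr_gt0.
have ik : 0 < i * (1 + kap) by rewrite mulr_gt0.
pose eta : R := g `^ th - 1.
have eta0 : 0 < eta.
  rewrite subr_gt0; have /(_ 1 g) := gt0_ltr_powR th0.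
  by rewrite !nnegrE powR1; apply; lra.
have gt : g `^ th = 1 + eta by rewrite /eta; ring.
clearbody eta.
pose beta : R := ((1 + vt) / 2) `^ th - vt `^ th.
have beta0 : 0 < beta.
  rewrite subr_gt0; have /(_ vt ((1 + vt) / 2)) := gt0_ltr_powR th0.
  by rewrite !nnegrE; apply; lra.
have betaE : ((1 + vt) / 2) `^ th = beta + vt `^ th by rewrite /beta subrK.
clearbody beta.
exists (eta^-1 + B / (beta * (1 - dsa))).
  by rewrite addr_gt0 ?invr_gt0 // divr_gt0 // mulr_gt0.
move=> X Y P G w Z X0 Y0 P0 G0 w0 Z0 hXP hPG hY hG.
set Xt := X `^ th in hY hG *.
have Xt0 : 0 <= Xt by apply: powR_ge0.
have c0 : 0 <= B / (beta * (1 - dsa)) by rewrite divr_ge0 ?ltW // mulr_gt0.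
(* Either [w] dominates and the first term of the constant suffices, or adding [w] to [Xt] costs at
   most the factor g^th = 1 + eta. *)
have [wbig|wsmall] := ltP (eta * Xt) w.
  apply: (@le_trans _ _ (eta^-1 * w)); first by rewrite ler_pdivlMl // ltW.
  have ei : 0 <= eta^-1 by rewrite invr_ge0 ltW.
  rewrite mulrDl mulrDr; have := mulr_ge0 ei Z0.
  by have := mulr_ge0 c0 (addr_ge0 w0 Z0); lra.
have [Xz|Xn] := eqVneq X 0.
  rewrite /Xt Xz powR0 ?gt_eqF // mulr_ge0 ?addr_ge0 //.
  by rewrite invr_ge0 ltW.
have Xp : 0 < X by rewrite lt_def Xn.
have hXw : Xt + w <= g `^ th * Xt by rewrite gt; lra.
have hY' : Y <= kap * g * X.
  apply: (ler_powR_cancel th0 Y0); first by rewrite !mulr_ge0 // ltW.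
  rewrite (le_trans hY) // !powRM ?mulr_ge0 ?(ltW kap0) ?(ltW gp) //.
  by rewrite -mulrA ler_wpM2l ?powR_ge0.
have hP1 : X <= P * (g * (1 + kap)).
  rewrite -(ler_pM2r Xp) -expr2 (le_trans hXP) // -!mulrA ler_wpM2l //.
  by nra.
pose W : R := (1 - i * xi) / (i * (1 + kap)).
(* The lower bound on [P] has factor 1 - xi; subtracting 1 - 1/i leaves 1/i - xi, which is still
   positive. *)
have hG1 : X * W <= G.
  have : X / (g * (1 + kap)) <= P by rewrite ler_pdivrMr.
  suff -> : X * W = X / (g * (1 + kap)) - (1 - i^-1) / (1 + kap) * X by lra.
  by rewrite /W !invfM giE; field; rewrite !gt_eqF.
have ixi : (1 + vt) / 2 * g <= 1 - i * xi.
  by rewrite -[g]invrK giE ler_pdivrMr; [nra|lra].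
have hG2 : X `^ th * (((1 + vt) / 2) `^ th * g `^ th) <= G `^ th * B.
  have v0 : 0 <= 1 + vt by lra.
  rewrite BE -!powRM ?mulr_ge0 ?(ltW i0) ?(ltW kap1) ?(ltW gp) //.
  apply: ler_powRl; rewrite ?mulr_ge0 ?(ltW th0) ?(ltW gp) //.
  apply: le_trans (ler_wpM2r (ltW ik) hG1).
  by rewrite -[X * W * _]mulrA /W divfK ?gt_eqF // ler_wpM2l.
have hG3 : G `^ th * B <= Z * B / (1 - dsa) + Th * (g `^ th * Xt).
  have -> : Z * B / (1 - dsa) + Th * (g `^ th * Xt) =
    (Z + Dt * (1 - dsa) * 2 `^ th * (kap `^ th * (g `^ th * Xt))) / (1 - dsa) * B.
    by rewrite -ThE; field; rewrite gt_eqF.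
  rewrite ler_wpM2r // ?(ltW B0) // ler_pdivlMr // mulrC (le_trans hG) // lerD2l.
  rewrite ler_wpM2l ?mulr_ge0 ?powR_ge0 ?(ltW Dt0) ?(ltW d1) //.
  by rewrite ler_wpM2l ?powR_ge0.
(* [hG2] and [hG3] enclose G^th B; their coefficients of g^th Xt differ by exactly [beta]. *)
have key : g `^ th * Xt * beta <= Z * B / (1 - dsa).
  by rewrite betaE -/Xt in hG2; rewrite -vtE in hG3; lra.
have key2 : Xt * beta <= Z * B / (1 - dsa).
  rewrite (le_trans _ key) // ler_wpM2r ?(ltW beta0) //.
  by rewrite gt ler_peMl //; lra.
have ei : 0 <= eta^-1 by rewrite invr_ge0 ltW.
have : Xt <= B / (beta * (1 - dsa)) * Z.
  rewrite -(ler_pM2r beta0) (le_trans key2) // le_eqVlt; apply/orP; left.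
  by apply/eqP; field; rewrite !gt_eqF.
have := mulr_ge0 ei (addr_ge0 w0 Z0); have := mulr_ge0 c0 w0.
by lra.
Qed.

End RecoveryConstant.

(** * Decomposition of an index set into blocks of decreasing entries *)

Section Shelling.
Variables (R : realType) (I : finType) (c : I -> R).
Implicit Types (S B T : {set I}).

(** Greedy selection: each step adds a largest remaining entry, whose value becomes the new
    separating threshold [tau]. *)
Lemma exists_largest (S : {set I}) (a : nat) :
  (forall i, 0 <= c i) -> (a <= #|S|)%N ->
  exists T tau, [/\ T \subset S, #|T| = a, 0 <= tau,
    forall i, i \in T -> tau <= c i & forall i, i \in S :\: T -> c i <= tau].
Proof.
move=> c0; elim: a => [|a IH] aS.
  (* With nothing selected, [tau] only has to bound every entry on [S]; the total does. *)
  exists finset.set0, (\sum_(i in S) c i).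
  split; rewrite ?finset.sub0set ?cards0 ?sumr_ge0 //.
    by move=> i; rewrite inE.
  by move=> i; rewrite finset.setD0 => iS; rewrite (bigD1 i) //= lerDl sumr_ge0.
have [T [tau [TS Ta tau0 hT hST]]] := IH (ltnW aS).
have /card_gt0P[i0 i0S] : (0 < #|S :\: T|)%N.
  by rewrite cardsD (finset.setIidPr TS) Ta subn_gt0.
have [i iST imax] : exists2 i, i \in S :\: T &
    forall j, j \in S :\: T -> c j <= c i.
  by case: (Order.TotalTheory.arg_maxP (fun i => c i) i0S) => i; exists i.
have /setDP[iS iT] := iST.
exists (i |: T), (c i); split => //.
- by rewrite finset.subUset finset.sub1set iS.
- by rewrite cardsU1 iT Ta.
- by move=> j /setU1P[->//|jT]; rewrite (le_trans (hST _ iST)) ?hT.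
- move=> j; rewrite !inE negb_or => /andP[/andP[_ jT] jS].
  by apply: imax; rewrite !inE jT.
Qed.

(* Successive blocks of the [a] largest entries: each entry of a block is at
   most every entry of the previous one, so the block's l2-norm is controlled by
   the previous block's lq-norm. *)
Lemma shelling (a : nat) (q : R) (S : {set I}) :
  (0 < a)%N -> 0 < q -> (forall i, 0 <= c i) ->
  exists T, [/\ T \subset S, (#|T| <= a)%N &
    forall (N : {set I} -> R) (L : R), 0 <= L -> N finset.set0 <= 0 ->
      (forall B B', [disjoint B & B'] -> N (B :|: B') <= N B + N B') ->
      (forall B, (#|B| <= a)%N ->
         N B <= L * (\sum_(i in B) c i ^+ 2) `^ (q / 2)) ->
      N (S :\: T) <= L * (a%:R `^ (q / 2 - 1) * \sum_(i in S) c i `^ q)].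
Proof.
move=> a0 q0 c0; have [k] := ubnP #|S|; elim: k S => // k IH S Sk.
have [Sa|aS] := leqP #|S| a.
  exists S; split=> // N L L0 N0 _ _.
  rewrite finset.setDv (le_trans N0) // !mulr_ge0 ?powR_ge0 // sumr_ge0 // => i _.
  exact: powR_ge0.
have [T [tau [TS Ta tau0 hT hST]]] := exists_largest c0 (ltnW aS).
have cSD : (#|S :\: T| < k)%N.
  rewrite cardsD (finset.setIidPr TS) Ta -ltnS (leq_trans _ Sk) //.
  by rewrite ltnS ltn_subrL a0 (leq_trans _ aS).
have [T' [T'S T'a hN]] := IH _ cSD.
exists T; split; rewrite ?Ta // => N L L0 N0 Nsub NL.
have ST : S :\: T = T' :|: ((S :\: T) :\: T').
  by rewrite -{1}(finset.setID (S :\: T) T') (finset.setIidPr T'S).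
rewrite ST (le_trans (Nsub _ _ _)) //.
  rewrite -finset.setI_eq0 finset.setIDA finset.setDIl finset.setDv.
  by apply/eqP/setP => i; rewrite !inE; case: (i \in T').
(* The sum over [T] pays for the block [T'], and the sum over the rest of [S] pays for what the
   induction hypothesis bounds. *)
have -> : \sum_(i in S) c i `^ q =
    \sum_(i in T) c i `^ q + \sum_(i in S :\: T) c i `^ q.
  by rewrite (big_setID T) /= (finset.setIidPr TS).
rewrite mulrDr mulrDr lerD ?hN // (le_trans (NL _ T'a)) // ler_wpM2l //.
have ap : 0 < a%:R :> R by rewrite ltr0n.
have h2 : 0 <= q / 2 by rewrite divr_ge0 ?ltW.
apply: (@le_trans _ _ ((a%:R * tau ^+ 2) `^ (q / 2))).
  apply: ler_powRl => //; first by apply: sumr_ge0 => i _; rewrite sqr_ge0.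
  apply: (@le_trans _ _ (\sum_(i in T') tau ^+ 2)).
    apply: ler_sum => i /(fintype.subsetP T'S) iST.
    by rewrite lerXn2r ?nnegrE ?hST.
  by rewrite sumr_const -[leLHS]mulr_natl ler_wpM2r ?sqr_ge0 // ler_nat.
rewrite powRM ?sqr_ge0 ?ler0n // -powR_mulrn // -powRrM [2 * _]mulrC divfK //.
rewrite powRB; last by rewrite lt0r_neq0 // implybT.
rewrite powRr1 ?ler0n // -mulrA ler_wpM2l ?powR_ge0 // ler_pdivlMl //.
rewrite -Ta mulr_natl -sumr_const ler_sum // => i iT.
by rewrite ler_powRl ?(ltW q0) // hT.
Qed.

End Shelling.

(** * Euclidean and lq estimates for vectors and their restrictions *)

Section Vectors.
Variable R : realType.

Definition sqnorm k (v : 'cV[R]_k) : R := \sum_i v i 0 ^+ 2.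
Definition dot k (u v : 'cV[R]_k) : R := (u^T *m v) 0 0.
Definition restrict k (B : {set 'I_k}) (v : 'cV[R]_k) : 'cV[R]_k :=
  \col_i (if i \in B then v i 0 else 0).

Lemma sqnorm_ge0 k (v : 'cV[R]_k) : 0 <= sqnorm v.
Proof. by apply: sumr_ge0 => i _; rewrite sqr_ge0. Qed.

Lemma dotE k (u v : 'cV[R]_k) : dot u v = \sum_i u i 0 * v i 0.
Proof. by rewrite /dot mxE; apply: eq_bigr => i _; rewrite mxE. Qed.

Lemma dotvv k (v : 'cV[R]_k) : dot v v = sqnorm v.
Proof. by rewrite dotE. Qed.

Lemma dot_mulmxl k l (D : 'M[R]_(k, l)) (u : 'cV[R]_l) (v : 'cV[R]_k) :
  dot (D *m u) v = dot u (D^T *m v).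
Proof. by rewrite /dot trmx_mul mulmxA. Qed.

(** The sum of the squares of Y x_i - S y_i is nonnegative and equals Y (X Y - S^2); if Y = 0 then S
    = 0 as well. *)
Lemma Cauchy_Schwarz_sum (I : finType) (x y : I -> R) :
  (\sum_i x i * y i) ^+ 2 <= (\sum_i x i ^+ 2) * (\sum_i y i ^+ 2).
Proof.
set S := \sum_i _; set X := \sum_i _; set Y := \sum_i _.
have Y0 : 0 <= Y by apply: sumr_ge0 => i _; rewrite sqr_ge0.
have : 0 <= \sum_i (Y * x i - S * y i) ^+ 2.
  by apply: sumr_ge0 => i _; rewrite sqr_ge0.
have -> : \sum_i (Y * x i - S * y i) ^+ 2 = Y * (X * Y - S ^+ 2).
  transitivity (\sum_i (Y ^+ 2 * x i ^+ 2
      + (- 2 * Y * S * (x i * y i) + S ^+ 2 * y i ^+ 2))).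
    by apply: eq_bigr => i _; ring.
  by rewrite !big_split /= -!mulr_sumr -/S -/X -/Y; ring.
have [Yz _|Yn] := eqVneq Y 0; last first.
  by rewrite pmulr_rge0 ?subr_ge0 // lt_def Yn.
have -> : S = 0.
  apply: big1 => i _; move/eqP: Yz.
  rewrite psumr_eq0; last by move=> j _; apply: sqr_ge0.
  move=> /allP /(_ i (mem_index_enum _)).
  by rewrite /= sqrf_eq0 => /eqP ->; rewrite mulr0.
by rewrite Yz mulr0 expr0n.
Qed.

Lemma dot_sqr_le k (u v : 'cV[R]_k) : dot u v ^+ 2 <= sqnorm u * sqnorm v.
Proof. by rewrite dotE Cauchy_Schwarz_sum. Qed.

Lemma tight_frame_trmx_sqnorm k l (D : 'M[R]_(k, l)) (h : 'cV[R]_k) :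
  tight_frame D -> sqnorm (D^T *m h) = sqnorm h.
Proof. by move=> DD; rewrite -!dotvv -dot_mulmxl mulmxA DD mul1mx. Qed.

(** Duality: the transpose is an isometry, so |D v|^4 = dot(v, D^T D v)^2 <= |v|^2 |D v|^2. *)
Lemma tight_frame_sqnorm_le k l (D : 'M[R]_(k, l)) (v : 'cV[R]_l) :
  tight_frame D -> sqnorm (D *m v) <= sqnorm v.
Proof.
move=> DD; have := dot_sqr_le v (D^T *m (D *m v)).
rewrite -dot_mulmxl dotvv (tight_frame_trmx_sqnorm _ DD) expr2.
have [->|n0] := eqVneq (sqnorm (D *m v)) 0; first by rewrite sqnorm_ge0.
by rewrite ler_pM2r // lt_def n0 sqnorm_ge0.
Qed.

Lemma l2_norm_powR k (v : 'cV[R]_k) (q : R) :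
  l2_norm v `^ q = sqnorm v `^ (q / 2).
Proof. by rewrite /l2_norm -powR12_sqrt ?sqnorm_ge0 // -powRrM mulrC. Qed.

Lemma lq_pow_ge0 k (q : R) (v : 'cV[R]_k) : 0 <= lq_pow q v.
Proof. by apply: sumr_ge0 => i _; rewrite powR_ge0. Qed.

Lemma lq_pow0 k (q : R) : 0 < q -> lq_pow q (0 : 'cV[R]_k) = 0.
Proof.
by move=> q0; apply: big1 => i _; rewrite mxE normr0 powR0 ?gt_eqF.
Qed.

Lemma lq_powN k (q : R) (v : 'cV[R]_k) : lq_pow q (- v) = lq_pow q v.
Proof. by apply: eq_bigr => i _; rewrite mxE normrN. Qed.

Lemma normD_powR_le (q x y : R) : 0 < q -> q <= 1 ->
  `|x + y| `^ q <= `|x| `^ q + `|y| `^ q.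
Proof.
move=> q0 q1; apply: le_trans (powR_subadditive q0 q1 (normr_ge0 _) (normr_ge0 _)).
by apply: ler_powRl; rewrite ?(ltW q0) ?ler_normD.
Qed.

Lemma lq_powD_le k (q : R) (u v : 'cV[R]_k) : 0 < q -> q <= 1 ->
  lq_pow q (u + v) <= lq_pow q u + lq_pow q v.
Proof.
move=> q0 q1; rewrite /lq_pow -big_split; apply: ler_sum => i _ /=.
by rewrite mxE normD_powR_le.
Qed.

Lemma restrictU k (B B' : {set 'I_k}) (v : 'cV[R]_k) :
  [disjoint B & B'] -> restrict (B :|: B') v = restrict B v + restrict B' v.
Proof.
move=> dBB; apply/colP => i; rewrite !mxE finset.in_setU.
case: (boolP (i \in B)) => [iB|_] /=; last by rewrite add0r.
by rewrite (disjointFr dBB iB) addr0.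
Qed.

Lemma restrictC k (B : {set 'I_k}) (v : 'cV[R]_k) :
  v = restrict B v + restrict (~: B) v.
Proof.
apply/colP => i; rewrite !mxE finset.in_setC.
by case: (i \in B); rewrite ?addr0 ?add0r.
Qed.

Lemma restrict_set0 k (v : 'cV[R]_k) : restrict finset.set0 v = 0.
Proof. by apply/colP => i; rewrite !mxE inE. Qed.

Lemma sqnorm_restrict k (B : {set 'I_k}) (v : 'cV[R]_k) :
  sqnorm (restrict B v) = \sum_(i in B) v i 0 ^+ 2.
Proof.
rewrite /sqnorm [RHS]big_mkcond; apply: eq_bigr => i _; rewrite mxE.
by case: ifP => // _; rewrite expr0n.
Qed.

Lemma sqnorm_restrictC k (B : {set 'I_k}) (v : 'cV[R]_k) :
  sqnorm v = sqnorm (restrict B v) + sqnorm (restrict (~: B) v).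
Proof.
rewrite !sqnorm_restrict /sqnorm (bigID (mem B)) /=; congr (_ + _).
by apply: eq_bigl => i; rewrite finset.in_setC.
Qed.

Lemma dot_restrict k (B : {set 'I_k}) (v : 'cV[R]_k) :
  dot (restrict B v) v = sqnorm (restrict B v).
Proof.
rewrite dotE; apply: eq_bigr => i _; rewrite mxE.
by case: ifP => _; rewrite ?mul0r ?expr0n.
Qed.

Lemma sparse_restrict k (B : {set 'I_k}) (v : 'cV[R]_k) j :
  (#|B| <= j)%N -> sparse j (restrict B v).
Proof.
apply: leq_trans; apply/subset_leq_card/fintype.subsetP => i.
by rewrite inE mxE; case: ifP => // _; rewrite eqxx.
Qed.

(** For finite [r] this is the power mean inequality with exponent q/r applied to the |v_i|^r; for
    infinite [r] every entry is at most [eps] and [inv_ext r] is 0. *)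
Lemma lq_pow_le_lr_norm k (q : R) (r : \bar R) (v : 'cV[R]_k) (eps : R) :
  0 < q -> q <= 1 -> (1%:E <= r)%E -> 0 <= eps -> lr_norm r v <= eps ->
  lq_pow q v <= k%:R `^ (1 - q * inv_ext r) * eps `^ q.
Proof.
move=> q0 q1; case: r => [r|_|//] /=.
  rewrite lee_fin => r1 eps0 nv.
  have r0 : 0 < r by lra.
  have qr : 0 < q / r by rewrite divr_gt0.
  have := sum_powR_le (finset.setTfor 'I_k) (t := q / r) (g := fun i => `|v i 0| `^ r) qr.
  rewrite ler_pdivrMr // mul1r => /(_ (le_trans q1 r1) (fun _ => powR_ge0 _ _)).
  have inT i : (i \in finset.setTfor 'I_k) = true by rewrite inE.
  rewrite !(eq_bigl xpredT _ inT) cardsT card_ord => H.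
  have -> : lq_pow q v = \sum_i (`|v i 0| `^ r) `^ (q / r).
    by apply: eq_bigr => i _; rewrite -powRrM mulrC divfK ?gt_eqF.
  apply: (le_trans H); rewrite ler_wpM2l ?powR_ge0 // mulrC powRrM.
  by rewrite ler_powRl ?powR_ge0 ?(ltW q0).
move=> eps0 nv; rewrite mulr0 subr0 powRr1 ?ler0n //.
apply: (@le_trans _ _ (\sum_(i < k) eps `^ q)); last first.
  by rewrite sumr_const card_ord mulr_natl.
apply: ler_sum => i _; apply: ler_powRl; rewrite ?(ltW q0) //.
by apply: le_trans nv; apply: (le_bigmax _ (fun i => `|v i 0|)).
Qed.

Lemma lr_normN k (r : \bar R) (v : 'cV[R]_k) : lr_norm r (- v) = lr_norm r v.
Proof.
case: r => [r||] /=; do ?[congr (_ `^ _)]; apply: eq_bigr => i _;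
  by rewrite mxE normrN.
Qed.

End Vectors.

(** * Recovery from the RIP and two comparisons of sparse norms *)

Section Core.
Variables (R : realType) (m n N d : nat).
Variables (A : 'M[R]_(m, n)) (Dbar : 'M[R]_(n, d)) (Psi : 'M[R]_(N, d)).
Variables (q da dsa : R) (iota s a : nat).
Hypotheses (q0 : 0 < q) (q1 : q <= 1) (s0 : (0 < s)%N) (sa : (s < a)%N).
Let rho : R := s%:R / a%:R.
Hypothesis Psi_tight : tight_frame Psi.
Hypothesis Dbar_le : forall v, sparse a v -> sqnorm (Dbar *m v) <= 2 * sqnorm v.
Hypothesis Psi_le : forall v, sparse (s + a) v ->
  sqnorm (Psi *m v) <= sqnorm (Dbar *m v)
    + (1 - iota%:R^-1) / (1 + rho `^ (2 / q - 1)) * sqnorm v.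
Hypothesis ripa : rip A Dbar q a da.
Hypothesis ripsa : rip A Dbar q (s + a) dsa.

(** Here [h] stands for the recovery error, [E] for the compression error and [Z] for the noise. The
    scaling of [w] is such that s^(1-q/2) w = 2 E. *)
Lemma core_recovery (K : R) (h : 'cV[R]_N) (T : {set 'I_d}) (E Z : R) :
  let u := Psi^T *m h in
  let w := 2 * E * s%:R `^ (q / 2 - 1) in
  0 < K -> recovery_bound da dsa rho iota q K ->
  (#|T| <= s)%N -> 0 <= E ->
  \sum_(i in ~: T) `|u i 0| `^ q <= \sum_(i in T) `|u i 0| `^ q + 2 * E ->
  lq_pow q (A *m (Dbar *m u)) <= Z ->
  sqnorm h `^ (q / 2) <= (2 * K + 1) * (w + Z) /\
  lq_pow q u <= 2 * s%:R `^ (1 - q / 2) * K * (w + Z) + 2 * E.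
Proof.
move=> u w K0 HK Ts E0 cone AZ.
have Z0 : 0 <= Z by apply: le_trans AZ; apply: lq_pow_ge0.
have sp : 0 < s%:R :> R by rewrite ltr0n.
have ap : 0 < a%:R :> R by rewrite ltr0n (leq_trans _ sa).
have rho0 : 0 < rho by rewrite divr_gt0.
have rho1 : rho <= 1 by rewrite ler_pdivrMr // mul1r ler_nat ltnW.
have th0 : 0 < q / 2 by rewrite divr_gt0.
have th1 : q / 2 <= 1 by rewrite ler_pdivrMr // mul1r (le_trans q1) // ler1n.
have w0 : 0 <= w by rewrite /w !mulr_ge0 ?powR_ge0.
have [[/andP[da0 _] ripA] [_ ripSA]] := (ripa, ripsa).
pose c i := `|u i 0|.
have c0 i : 0 <= c i by rewrite /c.
(* One choice of blocks serves every subadditive functional; it is used below for the Euclidean norm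
   and for the measurements. *)
have [T1 [T1S T1a shell]] := shelling (~: T) (leq_trans (ltn0Sn _) sa) q0 c0.
have sumc (B : {set 'I_d}) : \sum_(i in B) c i ^+ 2 = sqnorm (restrict B u).
  rewrite sqnorm_restrict; apply: eq_bigr => i _.
  by rewrite /c real_normK ?num_real.
pose B : {set 'I_d} := ~: T :\: T1; pose v := restrict (~: B) u.
have uE : v = u - restrict B u by rewrite /v {2}[u](restrictC B) addrC addKr.
have vs : sparse (s + a) v.
  apply: sparse_restrict; rewrite finset.setCD finset.setCK.
  by rewrite (leq_trans (leq_card_setU _ _)) // leq_add.
set X := sqnorm v; set Y := sqnorm (restrict B u).
have XY : sqnorm h = X + Y.
  rewrite -(tight_frame_trmx_sqnorm _ Psi_tight) -/u (sqnorm_restrictC B).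
  by rewrite addrC.
pose M := \sum_(i in ~: T) c i `^ q.
(* Power mean inequality over at most [s] indices, all of which lie in the support kept by [v]. *)
have hT : \sum_(i in T) c i `^ q <= s%:R `^ (1 - q / 2) * X `^ (q / 2).
  have h1 := sum_powR_le T th0 th1 (fun i => sqr_ge0 (c i)).
  rewrite (eq_bigr (fun i => c i `^ q)) in h1; last first.
    by move=> i _; rewrite -powR_mulrn // -powRrM mulrC divfK.
  apply: (le_trans h1); apply: ler_pM; rewrite ?powR_ge0 //.
    by apply: ler_powRl; rewrite ?subr_ge0 ?ler0n ?ler_nat.
  rewrite sumc; apply: ler_powRl; rewrite ?(ltW th0) ?sqnorm_ge0 //.
  rewrite /X /v !sqnorm_restrict [leLHS]big_mkcond [leRHS]big_mkcond.
  apply: ler_sum => i _; rewrite /B !inE; case: (i \in T); rewrite ?andbF //=.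
  by case: ifP => // _; rewrite sqr_ge0.
have hM : a%:R `^ (q / 2 - 1) * M <= rho `^ (1 - q / 2) * (X `^ (q / 2) + w).
  have sE : s%:R `^ (1 - q / 2) * s%:R `^ (q / 2 - 1) = 1 :> R.
    by rewrite -powRD ?lt0r_neq0 ?implybT // addrC addrA subrK subrr powRr0.
  have -> : rho `^ (1 - q / 2) = s%:R `^ (1 - q / 2) * a%:R `^ (q / 2 - 1).
    rewrite /rho powRM ?invr_ge0 ?ler0n // -[a%:R^-1]powR_inv1 ?ler0n // -powRrM.
    by rewrite mulN1r opprB.
  rewrite [_ * a%:R `^ _]mulrC -mulrA ler_wpM2l ?powR_ge0 //.
  rewrite /M (le_trans cone) // mulrDr /w.
  rewrite [2 * E * _]mulrC [X in _ <= _ + X]mulrA sE mul1r.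
  by rewrite lerD2r.
have hY : Y `^ (q / 2) <= rho `^ (1 - q / 2) * (X `^ (q / 2) + w).
  have := shell (fun B => (\sum_(i in B) c i ^+ 2) `^ (q / 2)) 1 ler01.
  rewrite mul1r -/B -/M [X in X `^ _ <= _ * _]sumc => H; apply: le_trans hM.
  apply: H.
  - by rewrite big_set0 powR0 // gt_eqF.
  - move=> B1 B2 dB.
    have -> : \sum_(i in B1 :|: B2) c i ^+ 2 =
        \sum_(i in B1) c i ^+ 2 + \sum_(i in B2) c i ^+ 2.
      by rewrite -bigU //; apply: eq_bigl => i; rewrite !inE.
    by apply: powR_subadditive => //; apply: sumr_ge0 => i _; apply: sqr_ge0.
  - by move=> B1 _; rewrite mul1r.
(* On each block the upper RIP bound of order [a] is followed by [Dbar_le], whence the factor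
   2^(q/2). *)
have hZ : lq_pow q (A *m (Dbar *m restrict B u)) <=
    (1 + da) * 2 `^ (q / 2) * (rho `^ (1 - q / 2) * (X `^ (q / 2) + w)).
  have L0 : 0 <= (1 + da) * 2 `^ (q / 2) by rewrite mulr_ge0 ?powR_ge0 ?addr_ge0.
  apply: le_trans (ler_wpM2l L0 hM).
  apply: (shell (fun B => lq_pow q (A *m (Dbar *m restrict B u))) _ L0).
  - by rewrite restrict_set0 !mulmx0 lq_pow0.
  - by move=> B1 B2 dB; rewrite restrictU // !mulmxDr lq_powD_le.
  - move=> B1 B1a; have B1s := sparse_restrict u B1a.
    have [_ /le_trans] := ripA _ B1s; apply.
    rewrite l2_norm_powR -mulrA ler_wpM2l ?addr_ge0 // sumc -powRM ?sqnorm_ge0 //.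
    by apply: ler_powRl; rewrite ?(ltW th0) ?sqnorm_ge0 ?Dbar_le.
(* As u = Psi^T h and [v] is a restriction of [u], |v|^2 is the inner product of Psi v with h. *)
have hX : X ^+ 2 <= sqnorm (Psi *m v) * (X + Y).
  have XE : X = dot (Psi *m v) h by rewrite dot_mulmxl -/u dot_restrict.
  by rewrite -XY XE dot_sqr_le.
(* Lower RIP bound of order [s + a] for [v], written as [u] minus its tail: [u] contributes [Z] and
   the tail is bounded by [hZ]. *)
have hG : (1 - dsa) * sqnorm (Dbar *m v) `^ (q / 2) <=
    Z + (1 + da) * 2 `^ (q / 2) * (rho `^ (1 - q / 2) * (X `^ (q / 2) + w)).
  rewrite -l2_norm_powR; have [/le_trans + _] := ripSA _ vs; apply.
  rewrite {1}uE !mulmxBr (le_trans (lq_powD_le _ _ q0 q1)) // lq_powN.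
  exact: lerD.
have key := HK _ _ _ _ _ _ (sqnorm_ge0 v) (sqnorm_ge0 (restrict B u))
  (sqnorm_ge0 (Psi *m v)) (sqnorm_ge0 (Dbar *m v)) w0 Z0 hX (Psi_le vs) hY hG.
have rr : rho `^ (1 - q / 2) <= 1.
  have th1' : 0 <= 1 - q / 2 by rewrite subr_ge0.
  by have := ler_powRl th1' (ltW rho0) rho1; rewrite powR1.
(* As [rho] <= 1, Y^(q/2) is at most X^(q/2) + w, so the total is at most 2 X^(q/2) + w; this gives
   2 K + 1. *)
split.
  rewrite XY (le_trans (powR_subadditive th0 th1 (sqnorm_ge0 _) (sqnorm_ge0 _))) //.
  have : Y `^ (q / 2) <= X `^ (q / 2) + w.
    by rewrite (le_trans hY) // ler_piMl // addr_ge0 ?powR_ge0.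
  by rewrite -/X in key; lra.
have -> : lq_pow q u = \sum_(i in T) c i `^ q + M.
  rewrite /lq_pow (bigID (mem T)) /=; congr (_ + _).
  by apply: eq_bigl => i; rewrite finset.in_setC.
have : s%:R `^ (1 - q / 2) * X `^ (q / 2) <= s%:R `^ (1 - q / 2) * (K * (w + Z)).
  by rewrite ler_wpM2l ?powR_ge0.
by rewrite -/M -/(c _) in cone; move: cone; rewrite -/M; lra.
Qed.

End Core.

(** * Concatenated and block-diagonal frames, and their mutual coherence *)

Section SplitFrames.
Variables (R : realType) (iota n : nat) (d : 'I_iota -> nat).
Variable D : forall k : 'I_iota, 'M[R]_(n, d k).

Let block (v : 'cV[R]_(\sum_(k < iota) d k)) k : 'cV[R]_n := D k *m submxcol v k.

Lemma Dbar_mul v : Dbar_of D *m v = \sum_k block v k.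
Proof. by rewrite -[v in LHS]submxcolK /Dbar_of mul_mxrow_mxcol. Qed.

Lemma Psi_mul v : Psi_of D *m v = \mxcol_k block v k.
Proof.
rewrite -[v in LHS]submxcolK /Psi_of mul_mxblock_mxrow; apply: eq_mxcol => k.
rewrite (bigD1 k) //= eqxx conform_mx_id big1 ?addr0 // => l.
by rewrite eq_sym => /negbTE ->; rewrite mul0mx.
Qed.

Lemma sqnorm_mxcol (p_ : 'I_iota -> nat) (C : forall k, 'cV[R]_(p_ k)) :
  sqnorm (\mxcol_k C k) = \sum_k sqnorm (C k).
Proof.
rewrite -dotvv /dot tr_mxcol mul_mxrow_mxcol summxE.
by apply: eq_bigr => k _; rewrite -dotvv.
Qed.

Lemma tight_frame_Psi : (forall k, tight_frame (D k)) -> tight_frame (Psi_of D).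
Proof.
move=> DD; rewrite /tight_frame /Psi_of tr_mxblock mul_mxblock.
apply/mxblockP => k l; rewrite mxblockK.
rewrite (bigD1 k) //= eqxx conform_mx_id big1 ?addr0; last first.
  by move=> j; rewrite eq_sym => /negbTE ->; rewrite mul0mx.
have [<-|kl] := eqVneq k l.
  rewrite conform_mx_id DD; apply/matrixP => i j; rewrite !mxE.
  by rewrite -[tagnat.Rank k i == _]val_eqE [_ == _ :> nat]tagnat.eq_Rank eqxx.
rewrite trmx0 mulmx0; apply/matrixP => i j; rewrite !mxE.
by rewrite -val_eqE [_ == _ :> nat]tagnat.eq_Rank (negbTE kl).
Qed.

(** Each diagonal block contributes D_k D_k^T = I. This makes the true signal feasible for the
    minimisation. *)
Lemma Dbar_trPsi_stack (f : 'I_iota -> 'cV[R]_n) :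
  (forall k, tight_frame (D k)) ->
  Dbar_of D *m ((Psi_of D)^T *m stack f) = \sum_k f k.
Proof.
move=> DD; rewrite /Psi_of /stack tr_mxblock mul_mxblock_mxrow mul_mxrow_mxcol.
apply: eq_bigr => k _; rewrite (bigD1 k) //= eqxx conform_mx_id big1 ?addr0.
  by rewrite mulmxA DD mul1mx.
by move=> l /negbTE ->; rewrite trmx0 mul0mx.
Qed.

Lemma sum_Rank (p_ : 'I_iota -> nat) (F : 'I_(\sum_k p_ k) -> R) :
  \sum_k \sum_(i < p_ k) F (tagnat.Rank k i) = \sum_j F j.
Proof.
rewrite sig_big_dep /= [RHS](reindex _ tagnat.rank_bij_on) /=.
by apply: eq_big => // -[k i].
Qed.

Lemma mutual_coherence_ge0 : 0 <= mutual_coherence D.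
Proof. exact: bigmax_ge_id. Qed.

Lemma Gram_le_mutual_coherence k l i j : k != l ->
  `|((D k)^T *m D l) i j| <= mutual_coherence D.
Proof.
move=> kl; have -> : ((D k)^T *m D l) i j = ((col i (D k))^T *m col j (D l)) 0 0.
  by rewrite !mxE; apply: eq_bigr => t _; rewrite !mxE.
rewrite /mutual_coherence.
apply: le_trans (le_bigmax _ (fun k => \big[Num.max/0]_(l < iota | l != k)
    \big[Num.max/0]_(i < d k) \big[Num.max/0]_(j < d l)
      `| ((col i (D k))^T *m col j (D l)) 0 0 |) k).
apply: le_trans (le_bigmax_cond _ (fun l => \big[Num.max/0]_(i < d k)
  \big[Num.max/0]_(j < d l) `| ((col i (D k))^T *m col j (D l)) 0 0 |) _);
  last by rewrite eq_sym; exact: kl.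
apply: le_trans (le_bigmax _ (fun i => \big[Num.max/0]_(j < d l)
  `| ((col i (D k))^T *m col j (D l)) 0 0 |) i).
exact: (le_bigmax _ (fun j => `| ((col i (D k))^T *m col j (D l)) 0 0 |)).
Qed.

Lemma dot_mulmx_le k l (M : 'M[R]_(k, l)) (mu : R) (u : 'cV[R]_k) (v : 'cV[R]_l) :
  (forall i j, `|M i j| <= mu) ->
  `|dot u (M *m v)| <= mu * ((\sum_i `|u i 0|) * (\sum_j `|v j 0|)).
Proof.
move=> Mmu; rewrite dotE (le_trans (ler_norm_sum _ _ _)) // mulrCA mulr_suml.
apply: ler_sum => i _; rewrite normrM ler_wpM2l // mxE mulr_sumr.
rewrite (le_trans (ler_norm_sum _ _ _)) //; apply: ler_sum => j _.
by rewrite normrM ler_wpM2r.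
Qed.

(* Summing the off-diagonal products of the blockwise l1-norms [al] gives
   [(sum al)^2 - sum al^2 <= (1 - 1/iota) (sum al)^2]. *)
Lemma sum_offdiag_le (al : 'I_iota -> R) :
  \sum_k \sum_(l | l != k) al k * al l
    <= (1 - iota%:R^-1) * (\sum_k al k) ^+ 2.
Proof.
have -> : \sum_k \sum_(l | l != k) al k * al l
    = (\sum_k al k) ^+ 2 - \sum_k al k ^+ 2.
  apply/eqP; rewrite eq_sym subr_eq -big_split /=; apply/eqP.
  rewrite expr2 mulr_suml; apply: eq_bigr => k _.
  by rewrite mulr_sumr (bigD1 k) //= addrC expr2.
rewrite mulrBl mul1r lerD2l lerN2.
(* Against the constant 1, Cauchy-Schwarz gives (sum al)^2 <= iota * sum al^2. *)
have := Cauchy_Schwarz_sum (fun=> 1) al.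
under eq_bigr do rewrite mul1r.
rewrite [X in _ <= X * _](eq_bigr (fun=> 1)); last by move=> *; rewrite expr1n.
rewrite sumr_const card_ord => H.
have [i0|i0] := posnP iota.
  have -> : iota%:R^-1 = 0 :> R by rewrite i0 invr0.
  by rewrite mul0r sumr_ge0 // => *; rewrite sqr_ge0.
by rewrite ler_pdivrMl // ltr0n.
Qed.

(** The difference consists of the cross-frame inner products, each at most the coherence times a
    product of blockwise l1-norms; sparsity then bounds the squared l1-norm of [v] by N |v|^2. *)
Lemma Dbar_Psi_sqnorm v N : sparse N v ->
  `|sqnorm (Dbar_of D *m v) - sqnorm (Psi_of D *m v)| <=
    (1 - iota%:R^-1) * (mutual_coherence D * N%:R) * sqnorm v.
Proof.
move=> sv; rewrite Psi_mul sqnorm_mxcol Dbar_mul.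
have -> : sqnorm (\sum_k block v k) - \sum_k sqnorm (block v k) =
    \sum_k \sum_(l | l != k) dot (block v k) (block v l).
  rewrite -dotvv /dot [(\sum_k block v k)^T]linear_sum /= mulmx_suml summxE -sumrB.
  apply: eq_bigr => k _; rewrite mulmx_sumr summxE (bigD1 k) //= -dotvv.
  by rewrite /dot [X in X - _]addrC addrK.
pose al k := \sum_i `|submxcol v k i 0|.
have offd k l : l != k ->
    `|dot (block v k) (block v l)| <= mutual_coherence D * (al k * al l).
  move=> lk; rewrite dot_mulmxl mulmxA; apply: dot_mulmx_le => i j.
  by apply: Gram_le_mutual_coherence; rewrite eq_sym.
apply: (@le_trans _ _ (mutual_coherence D *
    \sum_k \sum_(l | l != k) al k * al l)).
  rewrite mulr_sumr (le_trans (ler_norm_sum _ _ _)) //; apply: ler_sum => k _.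
  rewrite mulr_sumr (le_trans (ler_norm_sum _ _ _)) //; apply: ler_sum => l.
  exact: offd.
apply: (le_trans (ler_wpM2l mutual_coherence_ge0 (sum_offdiag_le al))).
have -> : \sum_k al k = \sum_j `|v j 0|.
  rewrite -(sum_Rank (fun j => `|v j 0|)); apply: eq_bigr => k _.
  by apply: eq_bigr => i _; rewrite mxE.
have : (\sum_j `|v j 0|) ^+ 2 <= N%:R * sqnorm v.
  (* Pairing with the indicator of the support brings in [N] instead of the dimension. *)
  have := Cauchy_Schwarz_sum (fun j => (v j 0 != 0)%:R) (fun j => `|v j 0|).
  rewrite [X in X ^+ 2 <= _](eq_bigr (fun j => `|v j 0|)); last first.
    by move=> j _; have [->|_] := eqVneq (v j 0) 0; rewrite ?normr0 ?mul0r ?mul1r.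
  move=> /le_trans; apply.
  rewrite [X in _ * X](eq_bigr (fun j => v j 0 ^+ 2)); last first.
    by move=> j _; rewrite real_normK ?num_real.
  rewrite ler_wpM2r ?sqnorm_ge0 //.
  rewrite [leLHS](eq_bigr (fun j => if v j 0 != 0 then 1 else 0)); last first.
    by move=> j _; case: (v j 0 != 0); rewrite ?expr1n ?expr0n.
  rewrite -big_mkcond sumr_const ler_nat (leq_trans _ sv) //.
  by apply: subset_leq_card; apply/fintype.subsetP => j; rewrite inE.
have c0 : 0 <= (1 - iota%:R^-1 : R).
  have [i0|i0] := posnP iota.
    by have -> : iota%:R^-1 = 0 :> R; rewrite ?subr0 // i0 invr0.
  by rewrite subr_ge0 invf_le1 ?ltr0n // ler1n.
move=> /(ler_wpM2l (mulr_ge0 c0 mutual_coherence_ge0)) H.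
by apply: le_trans (le_trans H _); rewrite le_eqVlt; apply/orP; left; apply/eqP; ring.
Qed.

End SplitFrames.

(** * The cone condition from minimality *)

Section Cone.
Variable R : realType.

Lemma le_lq_norm_pow k (q : R) (u v : 'cV[R]_k) :
  0 < q -> lq_norm q u <= lq_norm q v -> lq_pow q u <= lq_pow q v.
Proof.
by move=> q0; apply: ler_powR_cancel; rewrite ?invr_gt0 ?lq_pow_ge0.
Qed.

(** Apply the q-triangle inequality to x = (x + u) - u on [T] and to u = (x + u) - x off [T], then
    add the minimality inequality. *)
Lemma lq_pow_cone k (q : R) (x u : 'cV[R]_k) (T : {set 'I_k}) :
  0 < q -> q <= 1 -> lq_pow q (x + u) <= lq_pow q x ->
  \sum_(i in ~: T) `|u i 0| `^ q <=
    \sum_(i in T) `|u i 0| `^ q + 2 * \sum_(i in ~: T) `|x i 0| `^ q.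
Proof.
move=> q0 q1.
have split_sum (F : 'I_k -> R) :
    \sum_i F i = \sum_(i in T) F i + \sum_(i in ~: T) F i.
  rewrite (bigID (mem T)) /=; congr (_ + _).
  by apply: eq_bigl => i; rewrite finset.in_setC.
rewrite /lq_pow !split_sum.
have onT : \sum_(i in T) `|x i 0| `^ q <=
    \sum_(i in T) `|(x + u) i 0| `^ q + \sum_(i in T) `|u i 0| `^ q.
  rewrite -big_split; apply: ler_sum => i _ /=; rewrite mxE.
  rewrite -[X in `|X| `^ q <= _](addrK (u i 0)) -[in leRHS](normrN (u i 0)).
  exact: normD_powR_le.
have offT : \sum_(i in ~: T) `|u i 0| `^ q <=
    \sum_(i in ~: T) `|(x + u) i 0| `^ q + \sum_(i in ~: T) `|x i 0| `^ q.
  rewrite -big_split; apply: ler_sum => i _ /=; rewrite mxE.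
  rewrite -[X in `|X| `^ q <= _](addKr (x i 0)) addrC.
  by rewrite -[in leRHS](normrN (x i 0)) normD_powR_le.
by lra.
Qed.

(** [T] collects the kept indices; there are fewer than [s] of them when the dimension is below
    [s]. *)
Lemma keep_largest_tail (q : R) s k (x : 'cV[R]_k) : 0 < q ->
  exists2 T : {set 'I_k}, (#|T| <= s)%N &
    lq_pow q (x - keep_largest s x) = \sum_(i in ~: T) `|x i 0| `^ q.
Proof.
move=> q0; rewrite /keep_largest; set l := take s _.
exists [set i in l]%SET.
  by rewrite cardsE (leq_trans (card_size _)) // size_take_min geq_minl.
rewrite /lq_pow [RHS]big_mkcond; apply: eq_bigr => i _.
rewrite finset.in_setC !mxE inE -/l; case: (i \in l) => /=.
  by rewrite subrr normr0 powR0 // gt_eqF.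
by rewrite subr0.
Qed.

End Cone.

(** * Uniform constants and passage from coherence to norm bounds *)

Section Assembly.
Variable R : realType.

(** Moving the assumptions under the existential makes [K] a total function of the five parameters.
    Where no constant exists the assumptions are contradictory, and 1 is a default value. *)
Lemma total_recovery_constant (da dsa rho : R) (iota : nat) (q : R) :
  exists K, 0 < K /\
    ((0 < iota)%N -> 0 < q -> q <= 1 -> 0 < rho -> 0 <= da -> 0 <= dsa < 1 ->
     (1 + da) / (1 - dsa) * rho `^ (1 - q / 2)
       * (rho `^ (2 / q - 1) + 1) `^ (q / 2) < (2 * iota%:R) `^ (- (q / 2)) ->
     recovery_bound da dsa rho iota q K).
Proof.
have [[K [K0 HK]]|noK] := pselect (exists K, 0 < K /\ recovery_bound da dsa rho iota q K).
  by exists K.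
exists 1; split=> // i0 q0 q1 r0 da0 dsa01 h; exfalso; apply: noK.
by have [K] := recovery_constant i0 q0 q1 r0 da0 dsa01 h; exists K.
Qed.

(** The coherence assumption gives mu (s + a) <= 1/(1 + kap) <= 1. The first bound adds the
    deviation, at most |v|^2, to |Psi v|^2 <= |v|^2; the second keeps the sharper 1/(1 + kap). *)
Lemma incoherent_bounds (iota n : nat) (d : 'I_iota -> nat)
    (D : forall k : 'I_iota, 'M[R]_(n, d k)) (s a : nat) (kap : R) :
  (0 < iota)%N -> (forall k, tight_frame (D k)) -> 0 <= kap ->
  mutual_coherence D * (s + a)%:R * (kap + 1) < 1 ->
  (forall v, sparse a v -> sqnorm (Dbar_of D *m v) <= 2 * sqnorm v) /\
  (forall v, sparse (s + a) v -> sqnorm (Psi_of D *m v) <=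
     sqnorm (Dbar_of D *m v) + (1 - iota%:R^-1) / (1 + kap) * sqnorm v).
Proof.
move=> i0 DD kap0 coh.
have kap1 : 0 < 1 + kap by lra.
have c0 : 0 <= (1 - iota%:R^-1 : R) by rewrite subr_ge0 invf_le1 ?ltr0n // ler1n.
have c1 : (1 - iota%:R^-1 : R) <= 1 by rewrite gerBl invr_ge0 ler0n.
have mu0 := mutual_coherence_ge0 D; set mu := mutual_coherence D in coh mu0 *.
have musa : mu * (s + a)%:R <= (1 + kap)^-1.
  by rewrite -[leRHS]mul1r ler_pdivlMr // [1 + kap]addrC ltW.
split=> v sv.
  have /ler_normlP[_] := Dbar_Psi_sqnorm D sv; rewrite -/mu => h.
  have hP := tight_frame_sqnorm_le v (tight_frame_Psi DD).
  have mua : mu * a%:R <= 1.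
    apply: le_trans (_ : mu * (s + a)%:R <= 1).
      by rewrite ler_wpM2l // ler_nat leq_addl.
    by rewrite (le_trans musa) // invf_le1 // lerDl.
  have : (1 - iota%:R^-1) * (mu * a%:R) * sqnorm v <= 1 * sqnorm v.
    rewrite ler_wpM2r ?sqnorm_ge0 // mulr_ile1 // mulr_ge0 //.
  by lra.
have /ler_normlP[+ _] := Dbar_Psi_sqnorm D sv; rewrite -/mu => h.
have : (1 - iota%:R^-1) * (mu * (s + a)%:R) * sqnorm v <=
    (1 - iota%:R^-1) / (1 + kap) * sqnorm v.
  by rewrite ler_wpM2r ?sqnorm_ge0 // ler_wpM2l.
by lra.
Qed.

(** Take 1/q-th powers; separating the two errors costs the factor 2^(1/q). *)
Lemma l2_norm_root (q K w Z : R) k (h : 'cV[R]_k) : 0 < q -> 0 <= K ->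
  0 <= w -> 0 <= Z -> sqnorm h `^ (q / 2) <= K * (w + Z) ->
  l2_norm h <= (2 * K) `^ q^-1 * (w `^ q^-1 + Z `^ q^-1).
Proof.
move=> q0 K0 w0 Z0 H; have qi : 0 <= q^-1 by rewrite invr_ge0 ltW.
have -> : l2_norm h = (sqnorm h `^ (q / 2)) `^ q^-1.
  rewrite -l2_norm_powR powRVK ?gt_eqF //; exact: sqrtr_ge0.
apply: le_trans (ler_powRl qi (powR_ge0 _ _) H) _.
rewrite powRM ?addr_ge0 // [2 * K]mulrC powRM // -mulrA ler_wpM2l ?powR_ge0 //.
exact: powRD_le2.
Qed.

End Assembly.

(** * Error bounds for the minimiser, with constants built from [K] *)

Theorem theorem3p1 (R : realType) :
  exists C1 C2 C3 C4 : R -> R -> R -> nat -> R -> R,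
  (forall da dsa rho iota q,
     0 < C1 da dsa rho iota q /\ 0 < C2 da dsa rho iota q /\
     0 < C3 da dsa rho iota q /\ 0 < C4 da dsa rho iota q) /\
  forall (iota : nat) (q : R) (r : \bar R) (eps : R) (m n : nat)
    (A : 'M[R]_(m, n)) (d : 'I_iota -> nat)
    (D : forall k : 'I_iota, 'M[R]_(n, d k))
    (f : 'I_iota -> 'cV[R]_n) (z y : 'cV[R]_m)
    (s_ : 'I_iota -> nat) (a : nat) (delta_a delta_sa : R),
  (0 < iota)%N ->
  0 < q -> q <= 1 -> (1%:E <= r)%E -> 0 <= eps ->
  (forall k, tight_frame (D k)) ->
  y = A *m (\sum_(k < iota) f k) + z ->
  lr_norm r z <= eps ->
  (forall k, (0 < s_ k)%N) ->
  let s := (\sum_(k < iota) s_ k)%N in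
  (s < a)%N ->
  let rho := s%:R / a%:R : R in
  let Dbar := Dbar_of D in
  let Psi := Psi_of D in
  rip_const A Dbar q a delta_a ->
  rip_const A Dbar q (s + a) delta_sa ->
  let Delta := (1 + delta_a) / (1 - delta_sa) in
  mutual_coherence D * (s + a)%:R * (rho `^ (2 / q - 1) + 1) < 1 ->
  Delta * rho `^ (1 - q / 2) * (rho `^ (2 / q - 1) + 1) `^ (q / 2)
    < (2 * iota%:R) `^ (- (q / 2)) ->
  let F := stack f in
  forall fhat : 'cV[R]_(\sum_(k < iota) n),
    (* fhat solves  min ||Psi^* g||_q  s.t.  ||A Dbar Psi^* g - y||_r <= eps *)
    lr_norm r (A *m (Dbar *m (Psi^T *m fhat)) - y) <= eps ->
    (forall g : 'cV[R]_(\sum_(k < iota) n),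
       lr_norm r (A *m (Dbar *m (Psi^T *m g)) - y) <= eps ->
       lq_norm q (Psi^T *m fhat) <= lq_norm q (Psi^T *m g)) ->
    let c1 := C1 delta_a delta_sa rho iota q in
    let c2 := C2 delta_a delta_sa rho iota q in
    let c3 := C3 delta_a delta_sa rho iota q in
    let c4 := C4 delta_a delta_sa rho iota q in
    let x := Psi^T *m F in
    l2_norm (fhat - F)
      <= c1 * lq_norm q (x - keep_largest s x) / s%:R `^ (q^-1 - 2^-1)
         + c2 * m%:R `^ (q^-1 - inv_ext r) * eps
    /\
    lq_pow q (Psi^T *m fhat - x)
      <= c3 * lq_pow q (x - keep_largest s x)
         + c4 * a%:R `^ (1 - q / 2) * m%:R `^ (1 - q * inv_ext r) * eps `^ q.
Proof.
pose K da dsa rho iota q := projT1 (cid (@total_recovery_constant R da dsa rho iota q)).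
have KP da dsa rho iota q := projT2 (cid (@total_recovery_constant R da dsa rho iota q)).
(* The first factor is the root of the bound with 2 K + 1; the second comes from the 2 in front of
   both the compression error and the noise. *)
pose C da dsa rho iota q := (2 * (2 * K da dsa rho iota q + 1)) `^ q^-1 * 2 `^ q^-1.
have K_gt0 da dsa rho iota q : 0 < K da dsa rho iota q.
  by have [] := KP da dsa rho iota q.
(* With s^(1-q/2) w = 2 E and noise 2 Z0, the lq bound has 2 K * 2 E + 2 E and 2 K * 2 Z0. *)
exists C, C, (fun da dsa rho iota q => 4 * K da dsa rho iota q + 2),
  (fun da dsa rho iota q => 4 * K da dsa rho iota q).
split.
  move=> da dsa rho iota q; have K0 := K_gt0 da dsa rho iota q.
  have C0 : 0 < C da dsa rho iota q.
    by apply: mulr_gt0; apply: powR_gt0 => //; rewrite mulr_gt0 ?addr_gt0 ?mulr_gt0.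
  have K4 : 0 < 4 * K da dsa rho iota q by rewrite mulr_gt0.
  by split=> //; split=> //; split=> //; rewrite addr_gt0.
move=> iota q r eps m n A d D f z y s_ a da dsa i0 q0 q1 r1 eps0 DD yE zeps sk0 s sa rho
  Dbar Psi [ripa _] [ripsa _] Delta coh hD F fhat feas opt c1 c2 c3 c4 x.
have s0 : (0 < s)%N by rewrite /s (bigD1 (Ordinal i0)) //= addn_gt0 sk0.
have sp : 0 < s%:R :> R by rewrite ltr0n.
have ap : 0 < a%:R :> R by rewrite ltr0n (leq_trans _ sa).
have rho0 : 0 < rho by rewrite divr_gt0.
have [/andP[da0 _] _] := ripa; have [dsa01 _] := ripsa.
have K0 := K_gt0 da dsa rho iota q.
have [_ /(_ i0 q0 q1 rho0 da0 dsa01 hD) HK] := KP da dsa rho iota q.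
rewrite -/(K da dsa rho iota q) in K0 HK; set k := K _ _ _ _ _ in K0 HK.
have [Dle Ple] := incoherent_bounds i0 DD (powR_ge0 _ _) coh.
have PsiT := tight_frame_Psi DD.
have [T Ts EE] := keep_largest_tail s x q0.
set E := lq_pow q (x - keep_largest s x) in EE *.
have E0 : 0 <= E := lq_pow_ge0 _ _.
pose h := fhat - F; pose u := Psi^T *m h.
have uE : Psi^T *m fhat - x = u by rewrite /u /h mulmxBr.
have Feas : A *m (Dbar *m x) - y = - z.
  by rewrite /x /F Dbar_trPsi_stack // yE opprD addNKr.
have le_pow : lq_pow q (x + u) <= lq_pow q x.
  have FeasF : lr_norm r (A *m (Dbar *m x) - y) <= eps by rewrite Feas lr_normN.
  rewrite -uE addrC subrK; exact: (le_lq_norm_pow q0 (opt F FeasF)).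
have cone := lq_pow_cone T q0 q1 le_pow.
rewrite -EE in cone.
pose Z0 := m%:R `^ (1 - q * inv_ext r) * eps `^ q.
(* The measured error is the difference of the residuals of [fhat] and of [F], both feasible. *)
have AZ : lq_pow q (A *m (Dbar *m u)) <= 2 * Z0.
  have -> : A *m (Dbar *m u) = (A *m (Dbar *m (Psi^T *m fhat)) - y) + z.
    by rewrite -uE !mulmxBr -[z]opprK -Feas -/x opprB addrA subrK.
  apply: le_trans (lq_powD_le _ _ q0 q1) _.
  have h1 := lq_pow_le_lr_norm q0 q1 r1 eps0 feas.
  have h2 := lq_pow_le_lr_norm q0 q1 r1 eps0 zeps.
  by rewrite -/Z0 in h1 h2; lra.
have Z00 : 0 <= Z0 by rewrite mulr_ge0 ?powR_ge0.
have [] := core_recovery q0 q1 s0 sa PsiT Dle Ple ripa ripsa K0 HK Ts E0 cone AZ.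
set w := 2 * E * s%:R `^ (q / 2 - 1) => hl2 hlq.
have w0 : 0 <= w by rewrite !mulr_ge0 ?powR_ge0.
have qi : q^-1 != 0 by rewrite invr_eq0 gt_eqF.
split.
  have k1 : 0 <= 2 * k + 1 by rewrite addr_ge0 ?mulr_ge0 ?(ltW K0).
  have := l2_norm_root q0 k1 w0 (mulr_ge0 (ler0n _ 2) Z00) hl2.
  have -> : w `^ q^-1 = 2 `^ q^-1 * (lq_norm q (x - keep_largest s x)
      / s%:R `^ (q^-1 - 2^-1)).
    rewrite /w powRM ?mulr_ge0 ?powR_ge0 // powRM // -mulrA -powRrM -powRN.
    congr (_ * (_ * _ `^ _)).
    by rewrite mulrBl mul1r mulrAC divff ?gt_eqF // mul1r opprB.
  have -> : (2 * Z0) `^ q^-1 =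
      2 `^ q^-1 * (m%:R `^ (q^-1 - inv_ext r) * eps).
    rewrite !powRM ?mulr_ge0 ?powR_ge0 // powRVK ?gt_eqF // -powRrM.
    by congr (_ * (_ `^ _ * _)); rewrite mulrBl mul1r mulrAC divff ?gt_eqF // mul1r.
  move=> /le_trans; apply; rewrite /c1 /c2 /C -/k -/h.
  by rewrite le_eqVlt; apply/orP; left; apply/eqP; ring.
rewrite uE; apply: (le_trans hlq).
rewrite /c3 /c4 -/k.
have -> : 4 * k * a%:R `^ (1 - q / 2) * m%:R `^ (1 - q * inv_ext r) * eps `^ q =
    4 * (a%:R `^ (1 - q / 2) * (k * Z0)) by rewrite /Z0; ring.
have sE : s%:R `^ (1 - q / 2) * w = 2 * E.
  rewrite /w mulrCA -powRD ?lt0r_neq0 ?implybT //.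
  by rewrite addrA subrK subrr powRr0 mulr1.
(* The noise term is stated with [a], whereas the estimate on [T] produced [s]. *)
have sa' : s%:R `^ (1 - q / 2) <= a%:R `^ (1 - q / 2) :> R.
  apply: ler_powRl; rewrite ?ler0n ?ler_nat ?(ltnW sa) //.
  by rewrite subr_ge0 ler_pdivrMr // mul1r (le_trans q1) // ler1n.
have := ler_wpM2r (mulr_ge0 (ltW K0) Z00) sa'.
have -> : 2 * s%:R `^ (1 - q / 2) * k * (w + 2 * Z0) + 2 * E =
   2 * k * (s%:R `^ (1 - q / 2) * w) + 2 * E + 4 * (s%:R `^ (1 - q / 2) * (k * Z0)).
  by ring.
by rewrite sE; lra.
Qed.
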